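(* Let $F$ be Thompson's group with standard generators $\mathsf{x}_0,\mathsf{x}_1$, and let $\ell\in\mathbb{N}$. For $n\in\mathbb{N}$ let $g_{n,1},\dots,g_{n,\ell}\in F$, and suppose that the sequence of marked groups $(F,(\mathsf{x}_0,\mathsf{x}_1,g_{n,1},\dots,g_{n,\ell}))$, $n\in\mathbb{N}$, is convergent. Denote its limit by $\hat{G}$. Then $\hat{G}\neq F*K$ for any non-trivial subgroup $K<\hat{G}$.
   Context: Thompson's group $F$ is the group (under composition) of all increasing piecewise-linear homeomorphisms of $[0,1]$ that are differentiable except at finitely many dyadic rationals and whose slopes are integer powers of $2$. It is generated by $\mathsf{x}_0,\mathsf{x}_1$, where $\mathsf{x}_0(t)=\frac12 t$ on $[0,\frac12]$, $t-\frac14$ on $[\frac12,\frac34]$, $2t-1$ on $[\frac34,1]$; and $\mathsf{x}_1(t)=t$ on $[0,\frac12]$, $\frac12 t+\frac14$ on $[\frac12,\frac34]$, $t-\frac18$ on $[\frac34,\frac78]$, $2t-1$ on $[\frac78,1]$. Marked groups: a marked group $(G,(s_1,\dots,s_m))$ is a group with an ordered tuple of generators, considered up to isomorphism of marked groups. On the set $\mathcal{G}_m$ of groups marked by $m$ generators, two marked groups are at distance at most $e^{-r}$ if they have exactly the same relations of length at most $r$. Thus $(G_n,S_n)\to(G,S)$ iff for every word $w$ of the free group on $m$ letters: if $w(S)=1$ in $G$ then $w(S_n)=1$ in $G_n$ for all sufficiently large $n$, and if $w(S)\ne1$ in $G$ then $w(S_n)\neq1$ in $G_n$ for all sufficiently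 large $n$. In the limit $\hat G$ the subgroup generated by the first two markers is a copy of $F$ and is identified with $F$; $\hat G=F*K$ means that $\hat G$ is the (internal) free product of this subgroup $F$ and the subgroup $K$. *)

(* Defs.v *)
From HB Require Import structures.
From mathcomp Require Import all_boot all_order all_algebra.
From mathcomp Require Import all_classical all_reals all_analysis.
From mathcomp Require Import ring lra.

Set Implicit Arguments.
Unset Strict Implicit.
Unset Printing Implicit Defensive.

Import Order.TTheory GRing.Theory Num.Theory.

Local Open Scope classical_set_scope.
Local Open Scope ring_scope.

Section Generators.
Context {R : realFieldType}.
Implicit Types s t a b : R.

(* Both are extended by the identity outside [0, 1]. *)
Definition x0_fun t : R :=
  if t <= 0 then t else
  if t <= 1 / 2 then t / 2 else
  if t <= 3 / 4 then t - 1 / 4 else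
  if t <= 1 then 2 * t - 1 else t.

Definition x1_fun t : R :=
  if t <= 1 / 2 then t else
  if t <= 3 / 4 then t / 2 + 1 / 4 else
  if t <= 7 / 8 then t - 1 / 8 else
  if t <= 1 then 2 * t - 1 else t.

Definition x0_inv t : R :=
  if t <= 0 then t else
  if t <= 1 / 4 then 2 * t else
  if t <= 1 / 2 then t + 1 / 4 else
  if t <= 1 then (t + 1) / 2 else t.

Definition x1_inv t : R :=
  if t <= 1 / 2 then t else
  if t <= 5 / 8 then 2 * t - 1 / 2 else
  if t <= 3 / 4 then t + 1 / 8 else
  if t <= 1 then (t + 1) / 2 else t.

Local Ltac case_ifs := repeat match goal with
  |- context [if (?a <= ?b)%O then _ else _] =>
    lazymatch a with context [if _ then _ else _] => fail | _ => idtac end;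
    case: (leP a b) => ? /=
  end.

Lemma x0_out t : t \notin `[0, 1] -> x0_fun t = t.
Proof.
rewrite in_itv /= negb_and -!ltNge /x0_fun => /orP[] ?; case_ifs; lra.
Qed.

Lemma x1_out t : t \notin `[0, 1] -> x1_fun t = t.
Proof.
rewrite in_itv /= negb_and -!ltNge /x1_fun => /orP[] ?; case_ifs; lra.
Qed.

Lemma x0_mono : {mono x0_fun : s t / s <= t}.
Proof. by apply: le_mono => s t st; rewrite /x0_fun; case_ifs; lra. Qed.

Lemma x1_mono : {mono x1_fun : s t / s <= t}.
Proof. by apply: le_mono => s t st; rewrite /x1_fun; case_ifs; lra. Qed.

Lemma x0K : cancel x0_fun x0_inv.
Proof. by move=> t; rewrite /x0_fun /x0_inv; case_ifs; lra. Qed.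

Lemma x0_invK : cancel x0_inv x0_fun.
Proof. by move=> t; rewrite /x0_fun /x0_inv; case_ifs; lra. Qed.

Lemma x1K : cancel x1_fun x1_inv.
Proof. by move=> t; rewrite /x1_fun /x1_inv; case_ifs; lra. Qed.

Lemma x1_invK : cancel x1_inv x1_fun.
Proof. by move=> t; rewrite /x1_fun /x1_inv; case_ifs; lra. Qed.

Lemma x0_affine a b : 0 <= a -> a < b -> b <= 1 ->
    ~~ (a < 1 / 2 < b) -> ~~ (a < 3 / 4 < b) ->
  exists (z : int) (c : R), forall t, a <= t <= b -> x0_fun t = 2 ^ z * t + c.
Proof.
move=> a0 ab b1; rewrite !negb_and -!leNgt => /orP n1 /orP n2.
have [h|h] := leP b (1 / 2).
  by exists (-1), 0 => t ?; rewrite /x0_fun exprN1 {n1 n2}; case_ifs; lra.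
have {n1} ha : 1 / 2 <= a by case: n1 => //; lra.
have [h'|h'] := leP b (3 / 4).
  exists 0, (- (1 / 4)) => t ?; rewrite /x0_fun expr0z {n2}; case_ifs; lra.
have {n2} ha' : 3 / 4 <= a by case: n2 => //; lra.
by exists 1, (- 1) => t ?; rewrite /x0_fun expr1z; case_ifs; lra.
Qed.

Lemma x1_affine a b : 0 <= a -> a < b -> b <= 1 ->
    ~~ (a < 1 / 2 < b) -> ~~ (a < 3 / 4 < b) -> ~~ (a < 7 / 8 < b) ->
  exists (z : int) (c : R), forall t, a <= t <= b -> x1_fun t = 2 ^ z * t + c.
Proof.
move=> a0 ab b1; rewrite !negb_and -!leNgt => /orP n1 /orP n2 /orP n3.
have [h|h] := leP b (1 / 2).
  by exists 0, 0 => t ?; rewrite /x1_fun expr0z {n1 n2 n3}; case_ifs; lra.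
have {n1} ha : 1 / 2 <= a by case: n1 => //; lra.
have [h'|h'] := leP b (3 / 4).
  by exists (-1), (1 / 4) => t ?; rewrite /x1_fun exprN1 {n2 n3}; case_ifs; lra.
have {n2} ha' : 3 / 4 <= a by case: n2 => //; lra.
have [h''|h''] := leP b (7 / 8).
  by exists 0, (- (1 / 8)) => t ?; rewrite /x1_fun expr0z {n3}; case_ifs; lra.
have {n3} ha'' : 7 / 8 <= a by case: n3 => //; lra.
by exists 1, (- 1) => t ?; rewrite /x1_fun expr1z; case_ifs; lra.
Qed.

End Generators.

Section ThompsonPred.
Context {R : realType}.
Implicit Types (f g : R -> R) (a b s t : R).

Definition dyadic t : Prop := exists (m : int) (k : nat), t = m%:~R / 2 ^+ k.

Definition affine_pow2 f a b : Prop :=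
  exists (z : int) (c : R), forall t, a <= t <= b -> f t = 2 ^ z * t + c.

(* D is a finite set of dyadic points containing all the break points of f in
   ]0, 1[; f is affine, with slope a power of 2, on intervals avoiding D. *)
Definition dyadic_pl f : Prop :=
  exists D : seq R, (forall d, d \in D -> dyadic d) /\
    forall a b, 0 <= a -> a < b -> b <= 1 ->
      (forall d, d \in D -> ~~ (a < d < b)) -> affine_pow2 f a b.

(* A homeomorphism of [0, 1] is encoded by its extension to R by the identity,
   so that Leibniz equality of functions is equality on [0, 1].  An increasing
   bijection of [0, 1] onto itself is automatically a homeomorphism. *)
Definition thompson_pred f : Prop :=
  [/\ forall t, t \notin `[0, 1]%R -> f t = t,
      {in `[0, 1]%R &, {homo f : s t / s < t}},
      set_bij `[0, 1] `[0, 1] f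
    & dyadic_pl f].

Lemma dyadicD s t : dyadic s -> dyadic t -> dyadic (s + t).
Proof.
move=> [m [k ->]] [n [l ->]].
exists (m * 2 ^+ l + n * 2 ^+ k), (k + l)%N.
rewrite rmorphD !rmorphM !rmorphXn /= exprD.
by field; rewrite !expf_neq0 // pnatr_eq0.
Qed.

Lemma dyadicN t : dyadic t -> dyadic (- t).
Proof. by move=> [m [k ->]]; exists (- m), k; rewrite rmorphN mulNr. Qed.

Lemma dyadicZ t (z : int) : dyadic t -> dyadic (2 ^ z * t).
Proof.
move=> [m [k ->]]; case: z => n.
  by exists (2 ^+ n * m), k; rewrite rmorphM rmorphXn /= -exprnP; ring.
exists m, (n.+1 + k)%N; rewrite -[2 ^ Negz n]/((2 ^+ n.+1)^-1) exprD.
by field; rewrite !expf_neq0 // pnatr_eq0.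
Qed.

Lemma thompson_mono f : thompson_pred f -> {mono f : s t / s <= t}.
Proof.
move=> [fo fh [f01 _ _] _].
apply: le_mono => s t st.
have f01' x : 0 <= x <= 1 -> 0 <= f x <= 1.
  by move=> h; have := f01 x; rewrite /= !in_itv /=; apply.
have [s01|s01] := boolP (s \in `[0, 1]%R); have [t01|t01] := boolP (t \in `[0, 1]%R).
- exact: fh.
- rewrite (fo t) //; move: s01 t01; rewrite !in_itv /= => /[dup] /f01'; lra.
- rewrite (fo s) //; move: s01 t01; rewrite !in_itv /= => + /[dup] /f01'; lra.
- by rewrite !fo.
Qed.

Lemma thompson_can f : thompson_pred f ->
  exists g, cancel f g /\ cancel g f.
Proof.
move=> hf; have fm := thompson_mono hf; have fi := inc_inj fm.
case: hf => fo fh [_ _ fs] _.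
have fsurj y : exists x, f x = y.
  have [y01|y01] := boolP (y \in `[0, 1]%R); last by exists y; exact: fo.
  by have [x _ <-] := fs y y01; exists x.
pose g y := projT1 (cid (fsurj y)).
have gK : cancel g f by move=> y; rewrite /g; case: cid.
by exists g; split => // x; apply: fi; rewrite gK.
Qed.

Lemma thompson_intro f g :
  (forall t, t \notin `[0, 1]%R -> f t = t) -> {mono f : s t / s <= t} ->
  cancel f g -> cancel g f -> dyadic_pl f -> thompson_pred f.
Proof.
move=> fo fm fK gK fpl.
have f01 t : t \in `[0, 1]%R -> f t \in `[0, 1]%R.
  move=> t01; apply: contraT => ft.
  by move: (ft); rewrite (can_inj fK (fo _ ft)) t01.
split => //; first by move=> s t _ _; rewrite (leW_mono fm).
split.
- by move=> t /= /f01.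
- by move=> s t _ _; apply: (can_inj fK).
- move=> y /= y01; exists (g y); last exact: gK.
  rewrite /=; apply: contraT => gy.
  by move: (gy); rewrite -(fo _ gy) gK y01.
Qed.

Lemma thompson0 f : thompson_pred f -> f 0 = 0.
Proof.
move=> hf; have fm := thompson_mono hf; have fi := inc_inj fm.
case: hf => fo fh [f01 _ fs] _.
have [x /= x01 fx] : (f @` `[0, 1]) 0 by apply: fs; rewrite /= in_itv /=; lra.
have : f 0 <= 0 by rewrite -[leRHS]fx fm; move: x01; rewrite in_itv /= => /andP[].
have : `[0, 1]%classic (f 0) by apply: f01; rewrite /= in_itv /=; lra.
by rewrite /= in_itv /= => /andP[] *; apply/eqP; rewrite eq_le; apply/andP.
Qed.

Lemma seq_max (s : seq R) : s != [::] ->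
  exists2 u, u \in s & forall d, d \in s -> d <= u.
Proof.
elim: s => // x [_ _|y s IH _].
  by exists x; rewrite ?mem_head // => d; rewrite inE => /eqP->.
have [//|u us um] := IH; have [ux|xu] := leP u x.
  exists x; rewrite ?mem_head // => d.
  by rewrite in_cons => /orP[/eqP->//|/um /le_trans]; apply.
exists u; first by rewrite in_cons us orbT.
move=> d.
by rewrite in_cons => /orP[/eqP->|/um //]; exact: ltW.
Qed.

Lemma thompson_dyadic f t : thompson_pred f -> dyadic t -> dyadic (f t).
Proof.
move=> hf dt; have f0 := thompson0 hf; have := hf => -[fo _ _ [D [dD aff]]].
have [t01|t01] := boolP (t \in `[0, 1]%R); last by rewrite fo.
have [n] := ubnP (count (fun d => 0 < d < t) D).
elim: n t dt t01 => // n IH t dt t01; rewrite ltnS => cn.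
move: (t01); rewrite in_itv /= => /andP[t0 t1].
have [->|tn0] := eqVneq t 0; first by rewrite f0; exists 0, 0%N; rewrite mul0r.
have tp : 0 < t by rewrite lt_def tn0.
(* the last breakpoint before t, or 0 *)
have [u [u0 ut du dfu nou]] : exists u, [/\ 0 <= u, u < t, dyadic u, dyadic (f u) &
    forall d, d \in D -> ~~ (u < d < t)].
  have [/hasP[d0 d0D d0t]|/hasPn h] := boolP (has (fun d => 0 < d < t) D); last first.
    have d0 : dyadic 0 by exists 0, 0%N; rewrite mul0r.
    exists 0; rewrite f0; split => //; exact: h.
  pose s := [seq d <- D | 0 < d < t].
  have [|u us umax] := @seq_max s.
    apply/eqP => s0; have : d0 \in s by rewrite mem_filter d0t.
    by rewrite s0.
  move: us; rewrite mem_filter => /andP[/andP[u0 ut] uD].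
  exists u; split; [exact: ltW| exact: ut| exact: dD| |].
  - apply: IH; [exact: dD| by rewrite in_itv /=; lra|].
    apply: leq_trans cn.
    rewrite -[ltnRHS]size_filter -/s -(count_predC (fun d => d < u) s).
    have -> : count (fun d => 0 < d < u) D = count (fun d => d < u) s.
      rewrite count_filter; apply: eq_count => d /=.
      by apply/idP/idP; lra.
    rewrite -[ltnLHS]addn0 ltn_add2l -has_count; apply/hasP; exists u => /=.
      by rewrite mem_filter u0 ut.
    by rewrite ltxx.
  - move=> d dD'; apply/negP => /andP[ud dt'].
    have : d <= u by apply: umax; rewrite mem_filter dD' andbT; lra.
    lra.
have [z [c hz]] := aff u t u0 ut t1 nou.
have -> : f t = f u + 2 ^ z * (t + - u) by rewrite !hz ?lexx ?(ltW ut) //; ring.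
by apply: dyadicD => //; apply/dyadicZ/dyadicD => //; apply: dyadicN.
Qed.

Lemma thompson_inv f g : thompson_pred f -> cancel f g -> cancel g f ->
  thompson_pred g.
Proof.
move=> hf fK gK; have fm := thompson_mono hf.
have gm : {mono g : s t / s <= t} by move=> s t; rewrite -fm !gK.
have gl := leW_mono gm; have fl := leW_mono fm.
have f0 := thompson0 hf.
have go t : t \notin `[0, 1]%R -> g t = t.
  by move=> t01; have [fo _ _ _] := hf; rewrite -{1}(fo _ t01) fK.
apply: (thompson_intro go gm gK fK).
have [_ _ [_ _ fs] [D [dD aff]]] := hf.
have g0 : g 0 = 0 by rewrite -{1}f0 fK.
have g1 : g 1 <= 1.
  have [x /= x01 fx] : (f @` `[0, 1]) 1 by apply: fs; rewrite /= in_itv /=; lra.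
  by rewrite -[X in g X]fx fK; move: x01; rewrite in_itv /= => /andP[].
exists (map f D); split=> [d /mapP[e eD ->]|a b a0 ab b1 nD].
  by apply: thompson_dyadic => //; apply: dD.
have [||||z [c hz]] := aff (g a) (g b).
- by rewrite -g0 gm.
- by rewrite gl.
- by apply: le_trans g1; rewrite gm.
- by move=> d dD'; have := nD _ (map_f f dD'); rewrite -{1}(gK a) -{1}(gK b) !fl.
exists (- z), (- (2 ^ (- z) * c)) => t tab.
have := hz (g t); rewrite !gm gK => /(_ tab) {2}->.
rewrite mulrDr mulrA -expfzDr ?pnatr_eq0 // addNr expr0z; ring.
Qed.

Lemma thompson_comp f g : thompson_pred f -> thompson_pred g ->
  thompson_pred (f \o g).
Proof.
move=> hf hg; have fm := thompson_mono hf; have gm := thompson_mono hg.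
have [f' [fK f'K]] := thompson_can hf; have [g' [gK g'K]] := thompson_can hg.
have gl := leW_mono gm; have g0 := thompson0 hg.
have hg' := thompson_inv hg gK g'K.
have [fo _ _ [D [dD aff]]] := hf; have [go _ [g01 _ _] [E [dE afg]]] := hg.
apply: (@thompson_intro _ (g' \o f')); last 1 first.
- exists (E ++ map g' D); split=> [d|a b a0 ab b1 nD].
    rewrite mem_cat => /orP[/dE //|/mapP[e /dD de ->]].
    exact: thompson_dyadic.
  have [||||z [c hz]] := afg a b => //.
    by move=> d dE'; apply: nD; rewrite mem_cat dE'.
  have g1 : g 1 <= 1.
    have /g01 : `[0, 1]%classic (1 : R) by rewrite /= in_itv /=; lra.
    by rewrite /= in_itv /= => /andP[].
  have [||||w [e hw]] := aff (g a) (g b).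
  + by rewrite -g0 gm.
  + by rewrite gl.
  + by apply: le_trans g1; rewrite gm.
  + move=> d dD'; have := nD (g' d); rewrite mem_cat map_f ?orbT //.
    by rewrite -[a < _]gl -[_ < b]gl g'K => /(_ isT).
  exists (w + z), (2 ^ w * c + e) => t tab /=.
  by rewrite hw ?gm // hz // expfzDr ?pnatr_eq0 //; ring.
- by move=> t t01 /=; rewrite go ?fo.
- by move=> s t /=; rewrite fm gm.
- exact: can_comp.
- exact: can_comp.
Qed.

Lemma thompson_id : thompson_pred id.
Proof.
apply: (@thompson_intro id id) => //; exists [::]; split => // a b *.
by exists 0, 0 => t _; rewrite expr0z mul1r addr0.
Qed.

Lemma x0_pred : thompson_pred x0_fun.
Proof.
apply: (thompson_intro x0_out x0_mono x0K x0_invK).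
exists [:: 1 / 2; 3 / 4]; split=> [d|a b a0 ab b1 nD].
  rewrite !inE => /orP[] /eqP->.
    by exists 1, 1%N; rewrite expr1.
  by exists 3, 2%N; rewrite expr2 -natrM.
by apply: x0_affine => //; apply: nD; rewrite !inE eqxx ?orbT.
Qed.

Lemma x1_pred : thompson_pred x1_fun.
Proof.
apply: (thompson_intro x1_out x1_mono x1K x1_invK).
exists [:: 1 / 2; 3 / 4; 7 / 8]; split=> [d|a b a0 ab b1 nD].
  rewrite !inE => /or3P[] /eqP->.
  - by exists 1, 1%N; rewrite expr1.
  - by exists 3, 2%N; rewrite expr2 -natrM.
  - by exists 7, 3%N; rewrite -natrX.
by apply: x1_affine => //; apply: nD; rewrite !inE eqxx ?orbT.
Qed.

End ThompsonPred.

Record thompson (R : realType) :=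
  Thompson { thompson_fun :> R -> R; thompsonP : thompson_pred thompson_fun }.

Section ThompsonGroup.
Context {R : realType}.
Local Notation F := (thompson R).

HB.instance Definition _ := gen_eqMixin F.
HB.instance Definition _ := gen_choiceMixin F.

Lemma thompson_ext (f g : F) : f =1 g -> f = g.
Proof.
case: f g => f hf [g hg] /= /funext fg; rewrite fg in hf *.
by congr Thompson; exact: Prop_irrelevance.
Qed.

Definition thompson_one : F := Thompson thompson_id.

Definition thompson_mul (f g : F) : F :=
  Thompson (thompson_comp (thompsonP f) (thompsonP g)).

Lemma thompson_inv_ex (f : F) : exists g : F, cancel f g /\ cancel g f.
Proof.
have [g [fK gK]] := thompson_can (thompsonP f).
by exists (Thompson (thompson_inv (thompsonP f) fK gK)).
Qed.

Definition thompson_invg (f : F) : F := projT1 (cid (thompson_inv_ex f)).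

Lemma thompson_mulA : associative thompson_mul.
Proof. by move=> f g h; apply: thompson_ext. Qed.

Lemma thompson_mul1 : left_id thompson_one thompson_mul.
Proof. by move=> f; apply: thompson_ext. Qed.

Lemma thompson_mulr1 : right_id thompson_one thompson_mul.
Proof. by move=> f; apply: thompson_ext. Qed.

Lemma thompson_mulV : left_inverse thompson_one thompson_invg thompson_mul.
Proof.
move=> f; apply: thompson_ext => t /=.
by rewrite /thompson_invg; case: cid => g /= [-> _].
Qed.

Lemma thompson_mulrV : right_inverse thompson_one thompson_invg thompson_mul.
Proof.
move=> f; apply: thompson_ext => t /=.
by rewrite /thompson_invg; case: cid => g /= [_ ->].
Qed.

HB.instance Definition _ := isGroup.Build F
  thompson_mulA thompson_mul1 thompson_mulr1 thompson_mulV thompson_mulrV.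

Definition x0 : F := Thompson x0_pred.
Definition x1 : F := Thompson x1_pred.

End ThompsonGroup.
Arguments x0 : clear implicits.
Arguments x1 : clear implicits.

Local Open Scope group_scope.

Section Groups.
Context {G : groupType}.

Definition is_subgroup (K : set G) : Prop := group_closed (mem K).

Definition subgroup_gen (A : set G) : set G := smallest is_subgroup A.

(* Lists of syllables: (true, x) stands for x in H, (false, x) for x in K. *)
Definition reduced_seq (H K : set G) (w : seq (bool * G)) : Prop :=
  (forall p, p \in w -> p.2 != 1 /\ (if p.1 then H else K) p.2) /\
  sorted (fun p q => p.1 != q.1) w.

(* Every element has a unique normal form (the empty one for 1). *)
Definition internal_free_product (H K : set G) : Prop :=
  [/\ is_subgroup H, is_subgroup K &
    forall x : G, exists! w : seq (bool * G),
      reduced_seq H K w /\ x = \prod_(p <- w) p.2].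

End Groups.

Section MarkedGroups.
Context {m : nat}.

(* A group word in m letters; (i, false) is the i-th letter, (i, true) its
   inverse.  Allowing non-reduced words does not change which words of length
   at most r have to be tested, as free reduction shortens words. *)
Definition word := seq ('I_m * bool).

Definition word_eval (G : groupType) (S : m.-tuple G) (w : word) : G :=
  \prod_(p <- w) (if p.2 then (tnth S p.1)^-1 else tnth S p.1).

Definition is_marking (G : groupType) (S : m.-tuple G) : Prop :=
  subgroup_gen [set` S] = setT.

(* "At distance at most exp (- r)". *)
Definition same_relations (r : nat) (G1 G2 : groupType)
    (S1 : m.-tuple G1) (S2 : m.-tuple G2) : Prop :=
  forall w : word, (size w <= r)%N ->
    (word_eval S1 w = 1 <-> word_eval S2 w = 1).

Definition marked_cvg (Gs : nat -> groupType) (Ss : forall n, m.-tuple (Gs n))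
    (G : groupType) (S : m.-tuple G) : Prop :=
  forall r : nat, \forall n \near \oo, same_relations r (Ss n) S.

End MarkedGroups.

(* Main.v *)
(* F satisfies a law with constants: choose nontrivial a, b in F such that a is
   the identity on [1/2, 1] and b is the identity on [0, 1/2].  For g in F, if
   g(1/2) >= 1/2 then a ^ g and b have disjoint supports and commute; otherwise
   b ^ g and a do.  In both cases [~ [~ a ^ g, b], [~ b ^ g, a]] = 1, so this
   identity survives in every limit, for every element of the limit in place of
   g.  In F * K it fails for every nontrivial g in K, as the left-hand side
   is then a nonempty alternating word. *)
Require Import Defs.
From HB Require Import structures.
From mathcomp Require Import all_boot all_order all_algebra.
From mathcomp Require Import all_classical all_reals all_analysis.
From mathcomp Require Import lra.

Import Order.TTheory.

Local Open Scope classical_set_scope.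
Local Open Scope group_scope.

(** * Normal forms in a free product *)

Lemma free_product_commutator (G : groupType) (H K : set G) (a b k : G) :
  internal_free_product H K -> H a -> H b -> K k ->
  a <> 1 -> b <> 1 -> a <> b -> k <> 1 ->
  [~ [~ a ^ k, b], [~ b ^ k, a]] <> 1.
Proof.
move=> [sH sK nf] Ha Hb Kk /eqP a1 /eqP b1 /eqP ab /eqP k1 e.
have a1' : a^-1 != 1 by rewrite invg_eq1.
have b1' : b^-1 != 1 by rewrite invg_eq1.
have k1' : k^-1 != 1 by rewrite invg_eq1.
have ba1 : b * a^-1 != 1 by rewrite divg_eq1 eq_sym.
have Ha' : H a^-1 by have /mem_set/(group_closedV sH)/set_mem := Ha.
have Hb' : H b^-1 by have /mem_set/(group_closedV sH)/set_mem := Hb.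
have Kk' : K k^-1 by have /mem_set/(group_closedV sK)/set_mem := Kk.
have Hba : H (b * a^-1).
  by apply/set_mem/(group_closedM sH); apply/mem_set.
pose h x : bool * G := (true, x); pose q x : bool * G := (false, x).
(* The expanded double commutator. Its only cancellation is one [k * k^-1] in the middle, where [b]
   and [a^-1] merge into one syllable, nontrivial because [a <> b]. *)
pose w := [:: h b^-1; q k^-1; h a^-1; q k; h b; q k^-1; h a; q k; h a^-1;
  q k^-1; h b^-1; q k; h a; q k^-1; h (b * a^-1); q k; h b^-1; q k^-1; h a;
  q k; h b; q k^-1; h b^-1; q k; h a^-1; q k^-1; h b; q k; h a].
(* If the commutator were 1, both [w] and the empty list would be normal forms of 1. *)
have [v [_ vU]] := nf 1.
have vw : v = w.
  apply: vU; split.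
    split=> [p|//].
    by rewrite !inE; do !case/orP; move/eqP->.
  rewrite -[LHS]e /w !big_cons big_nil mulg1 /= !commgEl !conjgE !invgM !invgK.
  by rewrite !mulgA !(mulgK, mulgVK).
have v0 : v = [::] by apply: vU; split; rewrite ?big_nil.
by move: vw; rewrite v0.
Qed.

(** * Words, and relations passing to the limit *)

Section Words.
Context {m : nat}.
Implicit Types u v w : @word m.

Definition word_inv w : word := rev [seq (p.1, ~~ p.2) | p <- w].

Definition word_conj u v : word := word_inv v ++ u ++ v.

Definition word_comm u v : word := word_inv u ++ word_conj u v.

Section Eval.
Context {G : groupType} (S : m.-tuple G).

Lemma word_eval_nil : word_eval S [::] = 1.
Proof. exact: big_nil. Qed.

Lemma word_eval_cons p w : word_eval S (p :: w) =
  (if p.2 then (tnth S p.1)^-1 else tnth S p.1) * word_eval S w.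
Proof. exact: big_cons. Qed.

Lemma word_eval_cat u v : word_eval S (u ++ v) = word_eval S u * word_eval S v.
Proof. exact: big_cat. Qed.

Lemma word_evalV w : word_eval S (word_inv w) = (word_eval S w)^-1.
Proof.
elim: w => [|[i s] w IH]; first by rewrite /word_inv /= !word_eval_nil invg1.
rewrite word_eval_cons invgM -IH /word_inv /= rev_cons -cats1 word_eval_cat.
by rewrite word_eval_cons word_eval_nil mulg1; case: s => //=; rewrite invgK.
Qed.

Lemma word_evalJ u v :
  word_eval S (word_conj u v) = word_eval S u ^ word_eval S v.
Proof. by rewrite /word_conj !word_eval_cat word_evalV. Qed.

Lemma word_evalR u v :
  word_eval S (word_comm u v) = [~ word_eval S u, word_eval S v].
Proof. by rewrite /word_comm word_eval_cat word_evalV word_evalJ. Qed.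

Lemma marking_word (x : G) : is_marking S -> exists w, word_eval S w = x.
Proof.
move=> gS; have : subgroup_gen [set` S] x by rewrite gS.
apply: (_ : subgroup_gen _ `<=` [set y | exists w, word_eval S w = y]).
apply: smallest_sub => [|y /= /tnthP[i ->]]; last first.
  by exists [:: (i, false)]; rewrite word_eval_cons word_eval_nil mulg1.
split=> [|_ _ /set_mem[u <-] /set_mem[v <-]]; apply/mem_set.
  by exists [::]; rewrite word_eval_nil.
by exists (u ++ word_inv v); rewrite word_eval_cat word_evalV.
Qed.

(** Serves to place words in the first two letters inside the copy of F in the limit. *)
Lemma word_eval_sub (A : set G) w :
  (forall p, p \in w -> A (tnth S p.1)) -> subgroup_gen A (word_eval S w).
Proof.
move=> wA B [sB AB]; apply: set_mem; have [B1 _] := sB.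
elim: w wA => [|p w IH] wA; first by rewrite word_eval_nil.
rewrite word_eval_cons; apply: (group_closedM sB).
  have Bp : tnth S p.1 \in mem B.
    by apply/mem_set/AB/wA; rewrite mem_head.
  by case: p.2 => //; apply: (group_closedV sB).
by apply: IH => q qw; apply: wA; rewrite in_cons qw orbT.
Qed.

End Eval.

(** A single index is enough: the facts about F to be transferred hold for every [n]. *)
Lemma marked_cvg_rel {Gs : nat -> groupType} {Ss : forall n, m.-tuple (Gs n)}
    {G : groupType} {S : m.-tuple G} w :
  marked_cvg Ss S -> exists n, word_eval (Ss n) w = 1 <-> word_eval S w = 1.
Proof.
move=> /(_ (size w))[N _ /(_ N (leqnn N)) h].
by exists N; exact: h.
Qed.

End Words.

(** * The law with constants in F *)

Section ThompsonLaw.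
Context {R : realType}.
Implicit Types (f g p q : thompson R) (c t : R).

Lemma thompson_invE f t : f (f^-1 t) = t.
Proof. by have /(congr1 (fun g : thompson R => g t)) := mulgV f. Qed.

(** Both maps are increasing and fix [c], so each preserves the two half-lines cut at [c], and on
    each half-line one of them is the identity. *)
Lemma thompson_commute c p q :
  (forall t, (c <= t)%R -> p t = t) -> (forall t, (t <= c)%R -> q t = t) ->
  [~ p, q] = 1.
Proof.
move=> pc qc; apply/eqP/commgP/thompson_ext => t /=.
have pm := thompson_mono (thompsonP p); have qm := thompson_mono (thompsonP q).
have [tc|ct] := leP t c.
  by rewrite !qc // -(pc c (lexx c)) pm.
by rewrite [p t]pc ?(ltW ct) // pc // -(qc c (lexx c)) qm ltW.
Qed.

Lemma thompson_fixJ p g t : p (g t) = g t -> (p ^ g) t = t.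
Proof.
move=> pgt; apply: (inc_inj (thompson_mono (thompsonP g))).
by rewrite conjgE /= thompson_invE.
Qed.

Lemma thompson_law c p q g :
  (forall t, (c <= t)%R -> p t = t) -> (forall t, (t <= c)%R -> q t = t) ->
  [~ [~ p ^ g, q], [~ q ^ g, p]] = 1.
Proof.
move=> pc qc; have gm := thompson_mono (thompsonP g).
have [cg|gc] := leP c (g c).
  rewrite (@thompson_commute c (p ^ g) q) ?comm1g // => t ct.
  by apply/thompson_fixJ/pc/(le_trans cg); rewrite gm.
rewrite (_ : [~ q ^ g, p] = 1) ?commg1 //.
apply/eqP; rewrite commg1_sym; apply/eqP/(thompson_commute c) => // t tc.
by apply/thompson_fixJ/qc/(le_trans _ (ltW gc)); rewrite gm.
Qed.

(** * Explicit elements supported on either side of 1/2 *)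

Local Ltac case_ifs := repeat match goal with
  |- context [if (?a <= ?b)%O then _ else _] =>
    lazymatch a with context [if _ then _ else _] => fail | _ => idtac end;
    case: (leP a b) => ? /=
  end.

(* x0 and x1 agree on [7/8, 1], so x1^-1 * x0 is the identity there, and x0 ^ 2
   maps 7/8 to 1/2. *)
Definition left_elt : thompson R := x0 R * (x0 R * ((x1 R)^-1 * (x0 R)^-1)).

Lemma left_elt_fix t : (1 / 2 <= t)%R -> left_elt t = t.
Proof.
move=> t2.
(* Group inverses in F come from a choice and do not compute, so they are first replaced by the
   explicit formulas. *)
have e0 : (x0 R)^-1 t = x0_inv t.
  by apply: (can_inj x0K); rewrite x0_invK; exact: (thompson_invE (x0 R)).
have e1 : (x1 R)^-1 (x0_inv t) = x1_inv (x0_inv t).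
  by apply: (can_inj x1K); rewrite x1_invK; exact: (thompson_invE (x1 R)).
have -> : left_elt t = x0_fun (x0_fun (x1_inv (x0_inv t))).
  by rewrite -e1 -e0.
have [t1|t1] := leP t 1%R.
  (* Only the affine pieces ending at 1 occur: [u -> (u + 1) / 2] twice, then its inverse
     [u -> 2 * u - 1] twice. *)
  have -> : x0_inv t = ((t + 1) / 2)%R by rewrite /x0_inv; case_ifs; lra.
  have -> : x1_inv ((t + 1) / 2)%R = ((t + 3) / 4)%R.
    by rewrite /x1_inv; case_ifs; lra.
  have -> : x0_fun ((t + 3) / 4)%R = ((t + 1) / 2)%R.
    by rewrite /x0_fun; case_ifs; lra.
  by rewrite /x0_fun; case_ifs; lra.
have x0t : x0_fun t = t by rewrite /x0_fun; case_ifs; lra.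
have -> : x0_inv t = t by rewrite /x0_inv; case_ifs; lra.
by rewrite (_ : x1_inv t = t) ?x0t // /x1_inv; case_ifs; lra.
Qed.

Lemma x1_fix t : (t <= 1 / 2)%R -> x1 R t = t.
Proof. by rewrite /= /x1_fun => ->. Qed.

(** Since [left_elt] is [x0 * x0 * (x0 * x1)^-1], triviality would give [x0 = x1], but these differ
    at 1/2. *)
Lemma left_elt_neq1 : left_elt <> 1.
Proof.
rewrite /left_elt !mulgA -mulgA -invgM => /divg1_eq.
move=> /mulgI /(congr1 (fun f : thompson R => f (1 / 2)%R)) /=.
by rewrite /x0_fun /x1_fun; case_ifs; lra.
Qed.

(** Applied to the identity and to [left_elt], this separates [x1] from both. *)
Lemma x1_neq_fix f : (forall t, (1 / 2 <= t)%R -> f t = t) -> f <> x1 R.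
Proof.
move=> ff /(congr1 (fun f : thompson R => f (3 / 4)%R)).
by rewrite ff /= /x1_fun; case_ifs; lra.
Qed.

End ThompsonLaw.

(** * Transfer of the law to the limit *)

Theorem corollary3p3 (R : realType) (l : nat)
    (g : nat -> l.-tuple (thompson R))
    (Ghat : groupType) (s : l.+2.-tuple Ghat) :
  is_marking s ->
  marked_cvg (fun n : nat => [tuple of x0 R :: x1 R :: g n]) s ->
  forall K : set Ghat, is_subgroup K -> K <> [set 1] ->
    ~ internal_free_product
        (subgroup_gen [set tnth s ord0; tnth s (lift ord0 ord0)]) K.
Proof.
move=> ms cv K sK K1 fp.
have [k [Kk k1]] : exists k, K k /\ k <> 1.
  apply: contrapT => h; apply: K1; apply/seteqP; split => [x Kx|_ ->].
    by apply: contrapT => x1; apply: h; exists x.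
  by case: sK => /set_mem.
have [w wk] := marking_word s k ms.
pose i0 : 'I_l.+2 := ord0; pose i1 : 'I_l.+2 := lift ord0 ord0.
(* [wa] spells [left_elt] and [wb] spells [x1]; using only the first two letters, they have the same
   value in F for every [n]. *)
pose wa : word := [:: (i0, false); (i0, false); (i1, true); (i0, true)].
pose wb : word := [:: (i1, false)].
pose T n := [tuple of x0 R :: x1 R :: g n].
have wbE n : word_eval (T n) wb = x1 R.
  by rewrite word_eval_cons word_eval_nil mulg1.
have waE n : word_eval (T n) wa = left_elt.
  by rewrite !word_eval_cons word_eval_nil mulg1.
apply: (free_product_commutator _ _ _ (word_eval s wa) (word_eval s wb) k fp)
  => //.
- apply: (word_eval_sub s _ wa) => p; rewrite !inE.
  by do !case/orP; move/eqP-> => /=; [left|left|right|left].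
- by apply: (word_eval_sub s _ wb) => p; rewrite !inE => /eqP->; right.
- have [n wn] := marked_cvg_rel wa cv.
  by move=> /wn; rewrite waE; exact: left_elt_neq1.
- have [n wn] := marked_cvg_rel wb cv.
  by move=> /wn; rewrite wbE => /esym; exact: x1_neq_fix.
- have [n wn] := marked_cvg_rel (wa ++ word_inv wb) cv.
  move=> ab; have /wn : word_eval s (wa ++ word_inv wb) = 1.
    by rewrite word_eval_cat word_evalV ab mulgV.
  rewrite word_eval_cat word_evalV waE wbE => /divg1_eq.
  exact/x1_neq_fix/left_elt_fix.
(* The law as a word, with [w] spelling [k] in the limit. In F the value of [w] varies with [n] and
   is unknown, so the law is needed for an arbitrary conjugator. *)
pose W :=
  word_comm (word_comm (word_conj wa w) wb) (word_comm (word_conj wb w) wa).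
have [n wn] := marked_cvg_rel W cv.
have /wn : word_eval (T n) W = 1.
  rewrite !word_evalR !word_evalJ waE wbE.
  exact: (thompson_law (1 / 2)%R) left_elt_fix x1_fix.
by rewrite !word_evalR !word_evalJ wk.
Qed.
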